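(* Let $I=(a,b)$ be a bounded interval of the real axis, let $\beta,\gamma\in[-1/2,1/2]$, let $\omega(x)=(x-a)^{\beta}(b-x)^{\gamma}$, and let $M(\beta,\gamma)<p<m(\beta,\gamma)$, where $$m(\beta,\gamma)=4\min\left\{\frac{\beta+1}{2\beta+1},\frac{\gamma+1}{2\gamma+1}\right\},\qquad M(\beta,\gamma)=4\max\left\{\frac{\beta+1}{2\beta+3},\frac{\gamma+1}{2\gamma+3}\right\}.$$ Let $\alpha\in(0,1)$. Then there is a constant $C>0$, independent of $f$, such that $$\|I_{a+}^{\alpha}f\|_{L_{p}(I,\omega)}\leq C\|f\|_{L_{p}(I,\omega)}\qquad\text{for all } f\in L_{p}(I,\omega).$$
   Context: $L_{p}(I,\omega)$, $1\le p<\infty$, is the complex weighted Lebesgue space with norm $\|f\|_{L_p(I,\omega)}=\left(\int_a^b|f(x)|^p\omega(x)\,dx\right)^{1/p}$. The left-side Riemann-Liouville fractional integral of order $\alpha>0$ is $$(I_{a+}^{\alpha}f)(x)=\frac{1}{\Gamma(\alpha)}\int_a^x\frac{f(t)}{(x-t)^{1-\alpha}}\,dt.$$ A fraction $(\beta+1)/(2\beta+1)$ with $\beta=-1/2$ (and similarly for $\gamma$) is read as $+\infty$. *)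

(* Defs.v *)
From HB Require Import structures.
From mathcomp Require Import all_boot all_order all_algebra.
From mathcomp Require Import all_classical all_reals all_analysis.
From mathcomp Require Import complex.

Set Implicit Arguments.
Unset Strict Implicit.
Unset Printing Implicit Defensive.

Import Order.TTheory GRing.Theory Num.Theory.
Import numFieldNormedType.Exports.

Local Open Scope classical_set_scope.
Local Open Scope ring_scope.
Local Open Scope complex_scope.

(* Complex functions on the real line are handled through their real and
   imaginary parts, R[i] having no measurable structure in the library. *)

Definition Cmeasurable_fun (R : realType) (D : set R) (f : R -> R[i]) : Prop :=
  measurable_fun D (fun x => complex.Re (f x)) /\
  measurable_fun D (fun x => complex.Im (f x)).

Definition Cintegrable (R : realType) (D : set R) (f : R -> R[i]) : Prop :=
  lebesgue_measure.-integrable D (fun x => (complex.Re (f x))%:E) /\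
  lebesgue_measure.-integrable D (fun x => (complex.Im (f x))%:E).

(* Meaningful when Cintegrable D f holds. *)
Definition Cintegral (R : realType) (D : set R) (f : R -> R[i]) : R[i] :=
  (\int[lebesgue_measure]_(x in D) complex.Re (f x)) +i*
  (\int[lebesgue_measure]_(x in D) complex.Im (f x)).

Definition Gamma (R : realType) (s : R) : R :=
  \int[lebesgue_measure]_(t in `]0, +oo[) (t `^ (s - 1) * expR (- t)).

Definition jacobi_weight (R : realType) (a b beta gamma x : R) : R :=
  (x - a) `^ beta * (b - x) `^ gamma.

Definition wLp_norm (R : realType) (a b : R) (w : R -> R) (p : R)
    (f : R -> R[i]) : \bar R :=
  ((\int[lebesgue_measure]_(x in `]a, b[) (Normc.normc (f x) `^ p * w x)%:E)
     `^ p^-1)%E.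

(* Representatives of the elements of L_p(]a, b[, w): functions that are not
   identified modulo a.e. equality and whose values outside ]a, b[ are
   irrelevant. *)
Definition wLp (R : realType) (a b : R) (w : R -> R) (p : R) :
    set (R -> R[i]) :=
  [set f | Cmeasurable_fun `]a, b[ f /\ (wLp_norm a b w p f < +oo)%E].

Definition RL_integrand (R : realType) (alpha : R) (f : R -> R[i]) (x t : R) :
    R[i] :=
  f t / ((x - t) `^ (1 - alpha))%:C.

Definition RL_integral (R : realType) (a alpha : R) (f : R -> R[i]) (x : R) :
    R[i] :=
  (Gamma alpha)^-1%:C * Cintegral `]a, x[ (RL_integrand alpha f x).

(* Division by zero being total in R, the convention that the ratio is +oo
   at beta = -1/2 has to be imposed. *)
Definition upper_ratio (R : realType) (beta : R) : \bar R :=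
  if beta == - 2^-1 then +oo%E else ((beta + 1) / (2 * beta + 1))%:E.

Definition upper_exponent (R : realType) (beta gamma : R) : \bar R :=
  (4%:E * mine (upper_ratio beta) (upper_ratio gamma))%E.

Definition lower_exponent (R : realType) (beta gamma : R) : R :=
  4 * Num.max ((beta + 1) / (2 * beta + 3)) ((gamma + 1) / (2 * gamma + 3)).

(* Main.v *)
Require Import Defs.
From HB Require Import structures.
From mathcomp Require Import all_boot all_order all_algebra.
From mathcomp Require Import all_classical all_reals all_analysis.
From mathcomp Require Import complex.
From mathcomp Require Import measurable_realfun ring lra.

Set Implicit Arguments.
Unset Strict Implicit.
Unset Printing Implicit Defensive.

Import Order.TTheory GRing.Theory Num.Theory.
Import numFieldNormedType.Exports.

Local Open Scope classical_set_scope.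
Local Open Scope ring_scope.

(** The proof is Schur's test for the positive kernel (x - t)^(alpha - 1) on
    a < t < x < b, with a power of t - a as test function.

    Put u(t) = (t - a)^beta and let f be nonnegative. Writing
    f = (f u^(1/p)) u^(-1/p) and applying Hoelder's inequality with respect to
    the measure (x - t)^(alpha - 1) dt gives
      (int_a^x f(t) (x - t)^(alpha - 1) dt)^p
        <= A(x)^(p-1) int_a^x f(t)^p u(t) (x - t)^(alpha - 1) dt,
    where A(x) = int_a^x (t - a)^(-beta/(p-1)) (x - t)^(alpha - 1) dt is an
    Euler beta integral, hence at most a constant times
    (x - a)^(alpha - beta/(p-1)).  It converges because beta < p - 1, which is
    what the lower bound on p provides ([lower_exponent_lt]).  The exponent is
    such that the weight at a cancels:
      (x - a)^beta A(x)^(p-1) <= const (x - a)^(alpha (p-1)),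
    a bounded function.  After multiplying by the weight and integrating over
    x, Tonelli's theorem leaves the inner integral
      int_t^b (x - t)^(alpha - 1) (b - x)^gamma dx
        <= const (b - t)^(alpha + gamma) <= const (b - t)^gamma,
    another beta integral, and u(t) (b - t)^gamma is exactly the weight at t.

    The beta integrals are bounded in [beta_integral_le], the test itself is
    [schur_test], and [RL_kernel_schur] combines them.  For complex f
    everything is compared with the integral of |f| against the kernel,
    [RL_majorant].  The norm bound makes this majorant finite almost
    everywhere, which is the almost everywhere integrability claim;
    measurability of the fractional integral comes from Tonelli's theorem
    applied to positive and negative parts. *)

(** * Improper integrals of powers *)

Lemma measurable_fun_powR (d : measure_display) (T : measurableType d)
    (R : realType) (D : set T) (f : T -> R) (r : R) :
  measurable_fun D f -> measurable_fun D (fun t => f t `^ r).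
Proof. exact: (@measurableT_comp _ _ _ _ _ _ (@powR R ^~ r)). Qed.

(** One half of the fundamental theorem of calculus for integrands that may be
    singular at both endpoints: monotone convergence along the compact intervals
    [c + 1/n, d - 1/n] reduces it to the continuous case, and a bound on the
    increments of the primitive F, which may itself have no value of interest at c
    and d, passes to the limit. *)
Lemma ge0_integral_itvoo_le (R : realType) (f F : R -> R) (c d M : R) :
  c < d ->
  {in `]c, d[, forall x, 0 <= f x} ->
  {in `]c, d[, continuous f} ->
  {in `]c, d[, forall x, is_derive x (1 : R) F (f x)} ->
  {in `]c, d[ &, forall x y, x <= y -> F y - F x <= M} ->
  (\int[lebesgue_measure]_(x in `]c, d[) (f x)%:E <= M%:E)%E.
Proof.
move=> cd f0 cf dF FM.
pose h (n : nat) : R := n.+1%:R^-1.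
have h0 n : 0 < h n by rewrite invr_gt0.
have hle n m : (n <= m)%N -> h m <= h n.
  by move=> nm; rewrite lef_pV2 ?posrE// ler_nat.
pose D (n : nat) := `[c + h n, d - h n]%classic.
have Dsub n : D n `<=` `]c, d[.
  move=> x; rewrite /D /= !in_itv/= => /andP[h1 h2].
  by move: (h0 n) => hn; apply/andP; split; lra.
have -> : `]c, d[%classic = \bigcup_n D n.
  apply/seteqP; split; last by move=> x [n _ /Dsub].
  move=> x xcd; move: (xcd) (xcd).
  rewrite {1}itv_open_bnd_bigcup itv_bnd_open_bigcup /=.
  move=> [n _ /=]; rewrite in_itv/= => /andP[n1 _].
  move=> [m _ /=]; rewrite in_itv/= => /andP[_ m1].
  exists (maxn n m) => //; rewrite /D/= in_itv/=; apply/andP; split.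
    apply: le_trans n1; rewrite lerD2l; apply: hle; exact: leq_maxl.
  apply: (le_trans m1); rewrite lerD2l lerN2; apply: hle; exact: leq_maxr.
have mf : measurable_fun `]c, d[ f.
  by apply: open_continuous_measurable_fun => // x /[!inE]; exact: cf.
have cvgD : (\int[lebesgue_measure]_(x in D n) (f x)%:E)%E @[n --> \oo] -->
    (\int[lebesgue_measure]_(x in \bigcup_n D n) (f x)%:E)%E.
  apply: ge0_nondecreasing_set_cvg_integral.
  - move=> n m nm; rewrite subsetEset => x; rewrite /D/= !in_itv/=.
    by move: (hle _ _ nm) => h1 /andP[h2 h3]; apply/andP; split; lra.
  - by move=> n; exact: measurable_itv.
  - move=> n; apply: (measurable_funS _ (@Dsub n)) => //.
    exact/measurable_EFinP.
  - by move=> n x /Dsub xcd; rewrite lee_fin; apply: f0.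
rewrite -(cvg_lim _ cvgD)//; apply: lime_le.
  by apply/cvg_ex; eexists; exact: cvgD.
apply: nearW => n.
have M0 : 0 <= M.
  have mcd : (c + d) / 2 \in `]c, d[ by rewrite in_itv/=; apply/andP; split; lra.
  by have := FM _ _ mcd mcd (lexx _); rewrite subrr.
(* For small n the interval D n can be empty or a single point. *)
have [hn|hn] := ltP (c + h n) (d - h n); last first.
  rewrite (@integral_Sset1 _ _ _ (d - h n)) ?lee_fin//.
  move=> x; rewrite /D/= in_itv/= => /andP[h1 h2].
  by apply/eqP; rewrite eq_le h2 /=; lra.
have hL : c + h n \in `]c, d[.
  by move: (h0 n) => h1; rewrite in_itv/=; apply/andP; split; lra.
have hR : d - h n \in `]c, d[.
  by move: (h0 n) => h1; rewrite in_itv/=; apply/andP; split; lra.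
have cF x : x \in `]c, d[ -> {for x, continuous F}.
  move=> /dF dx; apply: differentiable_continuous.
  by apply/derivable1_diffP; case: dx.
rewrite (@continuous_FTC2 _ f F)//.
- by rewrite -EFinB lee_fin; apply: FM => //; exact: ltW.
- by apply: continuous_in_subspaceT => x /[!inE] /Dsub; exact: cf.
- split.
  + by move=> x /subset_itv_oo_cc /Dsub /dF[].
  + by apply: cvg_at_right_filter; exact: cF.
  + by apply: cvg_at_left_filter; exact: cF.
- by move=> x /subset_itv_oo_cc /Dsub /dF [_ dx]; rewrite derive1E.
Qed.

Lemma continuous_powR_gt0 (R : realType) (l s : R) : 0 < s ->
  {for s, continuous (fun x : R => x `^ l)}.
Proof.
move=> s0; apply: differentiable_continuous; apply/derivable1_diffP.
by apply: derivable_powR; rewrite in_itv/= s0.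
Qed.

Lemma integral_powR_left_le (R : realType) (c d l : R) : c < d -> - 1 < l ->
  (\int[lebesgue_measure]_(t in `]c, d[) ((t - c) `^ l)%:E
     <= ((d - c) `^ (l + 1) / (l + 1))%:E)%E.
Proof.
move=> cd l1.
have l10 : 0 < l + 1 by lra.
apply: (@ge0_integral_itvoo_le _ _ (fun t => (l + 1)^-1 * (t - c) `^ (l + 1))) => //.
- by move=> x _; exact: powR_ge0.
- move=> x; rewrite in_itv/= => /andP[cx xd].
  apply: (@continuous_comp _ _ _ (fun t : R => t - c) (fun t => t `^ l)).
    by apply: cvgB; [exact: cvg_id|exact: cvg_cst].
  by apply: continuous_powR_gt0; rewrite subr_gt0.
- move=> x; rewrite in_itv/= => /andP[cx xd].
  have xc0 : 0 < x - c by rewrite subr_gt0.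
  have h1 := is_derive1_powR (l + 1) xc0.
  have h2 : is_derive x (1:R) (fun t => t - c) 1.
    rewrite (_ : (fun t => t - c) = id - cst c)//.
    by apply: is_derive_eq; rewrite subr0.
  have h3 := @is_derive1_comp _ (fun t : R => t `^ (l + 1))
    (fun t => t - c) x _ _ h1 h2.
  have h4 := @is_deriveZ _ _ _ _ (l + 1)^-1 _ _ _ h3.
  apply: (@is_derive_eq _ _ _ _ _ _ _ _ h4).
  by rewrite /GRing.scale/= addrK mulr1 mulrA mulVf ?mul1r// gt_eqF.
- move=> x y; rewrite !in_itv/= => /andP[cx xd] /andP[cy yd] xy.
  rewrite -mulrBr mulrC ler_pM2r ?invr_gt0//.
  rewrite lerBlDr ler_wpDr ?powR_ge0// ge0_ler_powR ?nnegrE; lra.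
Qed.

Lemma integral_powR_right_le (R : realType) (c d l : R) : c < d -> - 1 < l ->
  (\int[lebesgue_measure]_(t in `]c, d[) ((d - t) `^ l)%:E
     <= ((d - c) `^ (l + 1) / (l + 1))%:E)%E.
Proof.
move=> cd l1.
have l10 : 0 < l + 1 by lra.
apply: (@ge0_integral_itvoo_le _ _
  (fun t => - (l + 1)^-1 * (d - t) `^ (l + 1))) => //.
- by move=> x _; exact: powR_ge0.
- move=> x; rewrite in_itv/= => /andP[cx xd].
  apply: (@continuous_comp _ _ _ (fun t : R => d - t) (fun t => t `^ l)).
    by apply: cvgB; [exact: cvg_cst|exact: cvg_id].
  by apply: continuous_powR_gt0; rewrite subr_gt0.
- move=> x; rewrite in_itv/= => /andP[cx xd].
  have xc0 : 0 < d - x by rewrite subr_gt0.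
  have h1 := is_derive1_powR (l + 1) xc0.
  have h2 : is_derive x (1:R) (fun t => d - t) (-1).
    rewrite (_ : (fun t => d - t) = cst d - id)//.
    by apply: is_derive_eq; rewrite sub0r.
  have h3 := @is_derive1_comp _ (fun t : R => t `^ (l + 1))
    (fun t => d - t) x _ _ h1 h2.
  have h4 := @is_deriveZ _ _ _ _ (- (l + 1)^-1) _ _ _ h3.
  apply: (@is_derive_eq _ _ _ _ _ _ _ _ h4).
  by rewrite /GRing.scale/= addrK mulrN1 mulrNN mulrA mulVf ?mul1r// gt_eqF.
- move=> x y; rewrite !in_itv/= => /andP[cx xd] /andP[cy yd] xy.
  rewrite !mulNr opprK addrC -mulrBr mulrC ler_pM2r ?invr_gt0//.
  rewrite lerBlDr ler_wpDr ?powR_ge0// ge0_ler_powR ?nnegrE; lra.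
Qed.

Lemma powR_le_double (R : realType) (l r L : R) : 0 < L -> L / 2 <= r <= L ->
  r `^ l <= 2 `^ `|l| * L `^ l.
Proof.
move=> L0 /andP[Lr rL].
have r0 : 0 < r by lra.
have h1 : 1 <= 2 `^ `|l| :> R.
  by rewrite -[leLHS](powRr0 2) ler_powR ?ler1n.
have [l0|l0] := leP 0 l.
  rewrite -[leLHS]mul1r ler_pM ?powR_ge0//.
  by rewrite ge0_ler_powR ?nnegrE//; lra.
rewrite ltr0_norm//.
have -> : 2 `^ (- l) * L `^ l = ((L / 2) `^ (- l))^-1.
  rewrite -powRN opprK powRM ?invr_ge0 ?ltW// mulrC; congr (_ * _).
    by rewrite -powR_inv1// -powRrM mulN1r.
have -> : r `^ l = (r `^ (- l))^-1 by rewrite powRN invrK.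
rewrite lef_pV2 ?posrE ?powR_gt0//; last lra.
by rewrite ge0_ler_powR ?nnegrE; lra.
Qed.

(** One of s, r is at least half of s + r, and there its power is comparable to
    that of s + r. This separates the two singularities of a beta integrand. *)
Lemma powR_mul_le (R : realType) (l m s r : R) : 0 < s -> 0 < r ->
  s `^ l * r `^ m <=
    2 `^ `|m| * (s + r) `^ m * s `^ l + 2 `^ `|l| * (s + r) `^ l * r `^ m.
Proof.
move=> s0 r0; have sr0 : 0 < s + r by lra.
have [sr|rs] := leP s r.
  rewrite ler_wpDr ?mulr_ge0 ?powR_ge0// mulrC ler_wpM2r ?powR_ge0//.
  by apply: powR_le_double => //; lra.
rewrite ler_wpDl ?mulr_ge0 ?powR_ge0// ler_wpM2r ?powR_ge0//.
by apply: powR_le_double => //; lra.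
Qed.

(** The sharp B is Euler's beta function at (l + 1, m + 1); any constant that
    does not depend on the interval will do for Schur's test. *)
Lemma beta_integral_le (R : realType) (l m : R) : - 1 < l -> - 1 < m ->
  exists2 B : R, 0 <= B & forall c d, c < d ->
    (\int[lebesgue_measure]_(t in `]c, d[) ((t - c) `^ l * (d - t) `^ m)%:E
       <= (B * (d - c) `^ (l + m + 1))%:E)%E.
Proof.
move=> l1 m1; have l0 : 0 < l + 1 by lra. have m0 : 0 < m + 1 by lra.
exists (2 `^ `|m| / (l + 1) + 2 `^ `|l| / (m + 1)).
  by rewrite addr_ge0// divr_ge0 ?powR_ge0// ltW.
move=> c d cd.
have dc0 : 0 < d - c by lra.
have mL : measurable_fun [set: R] (fun t : R => (t - c) `^ l).
  apply: measurable_fun_powR.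
  exact: measurable_funB.
have mR : measurable_fun [set: R] (fun t : R => (d - t) `^ m).
  apply: measurable_fun_powR.
  exact: measurable_funB.
pose KL : R := 2 `^ `|m| * (d - c) `^ m.
pose KR : R := 2 `^ `|l| * (d - c) `^ l.
have KL0 : 0 <= KL by rewrite mulr_ge0 ?powR_ge0.
have KR0 : 0 <= KR by rewrite mulr_ge0 ?powR_ge0.
apply: (@le_trans _ _ (\int[lebesgue_measure]_(t in `]c, d[)
    (KL%:E * ((t - c) `^ l)%:E + KR%:E * ((d - t) `^ m)%:E))%E).
  apply: ge0_le_integral => //.
  - by move=> t _; rewrite lee_fin mulr_ge0 ?powR_ge0.
  - apply/measurable_EFinP; apply: measurable_funTS; exact: measurable_funM.
  - apply: emeasurable_funD; apply/measurable_EFinP; apply: measurable_funTS;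
      exact: measurable_funM.
  - move=> t /=; rewrite in_itv/= => /andP[ct td].
    rewrite -!EFinM -EFinD lee_fin /KL /KR.
    have -> : d - c = (t - c) + (d - t) by ring.
    by apply: powR_mul_le; rewrite subr_gt0.
rewrite ge0_integralD//; last 4 first.
- by move=> t _; rewrite mule_ge0 ?lee_fin ?powR_ge0.
- by apply/measurable_EFinP; apply: measurable_funTS; exact: measurable_funM.
- by move=> t _; rewrite mule_ge0 ?lee_fin ?powR_ge0.
- by apply/measurable_EFinP; apply: measurable_funTS; exact: measurable_funM.
rewrite !ge0_integralZl//; last 4 first.
- by apply/measurable_EFinP; exact: measurable_funTS.
- by move=> t _; rewrite lee_fin powR_ge0.
- by apply/measurable_EFinP; exact: measurable_funTS.
- by move=> t _; rewrite lee_fin powR_ge0.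
apply: (@le_trans _ _ (KL%:E * ((d - c) `^ (l + 1) / (l + 1))%:E +
    KR%:E * ((d - c) `^ (m + 1) / (m + 1))%:E)%E).
  apply: leeD; apply: lee_wpmul2l; rewrite ?lee_fin//.
    exact: integral_powR_left_le.
  exact: integral_powR_right_le.
rewrite -!EFinM -EFinD lee_fin le_eqVlt; apply/orP; left; apply/eqP.
have dcn0 : d - c != 0 by rewrite gt_eqF.
rewrite /KL /KR !powRD ?dcn0 ?implybT//.
by ring.
Qed.

(** * Schur's test *)

Lemma ge0_lee_poweR (R : realType) (r : R) (x y : \bar R) :
  0 <= r -> (0 <= x)%E -> (x <= y)%E -> (x `^ r <= y `^ r)%E.
Proof.
move=> r0 x0 xy; apply: gt0_ler_poweR => //; rewrite in_itv/= leey andbT//.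
exact: le_trans xy.
Qed.

(** Hoelder's inequality raised to the power p, for integrals that may be
    infinite. *)
Lemma hoelder_powR (d : measure_display) (Y : measurableType d) (R : realType)
    (nu : {measure set Y -> \bar R}) (p : R) (F H : Y -> R) :
  1 < p -> measurable_fun setT F -> measurable_fun setT H ->
  (forall y, 0 <= F y) -> (forall y, 0 <= H y) ->
  ((\int[nu]_y (F y `^ p^-1 * H y `^ (1 - p^-1))%:E) `^ p <=
     (\int[nu]_y (F y)%:E) * (\int[nu]_y (H y)%:E) `^ (p - 1))%E.
Proof.
move=> p1 mF mH F0 H0.
have p0 : 0 < p by lra.
have pn0 : p != 0 by rewrite gt_eqF.
have pV1 : p^-1 < 1 by rewrite invf_lt1.
pose q := (1 - p^-1)^-1.
have q0 : 0 < q by rewrite invr_gt0 subr_gt0.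
have qn0 : q != 0 by rewrite gt_eqF.
have pq : p^-1 + q^-1 = 1 by rewrite invrK; ring.
have qp : q^-1 * p = p - 1 by rewrite invrK mulrBl mul1r mulVf.
pose f y := F y `^ p^-1; pose g y := H y `^ q^-1.
have mf : measurable_fun setT f.
  exact: measurable_fun_powR.
have mg : measurable_fun setT g.
  exact: measurable_fun_powR.
have N1 : 'N[nu]_1[EFin \o (f \* g)%R]%E =
    (\int[nu]_y (F y `^ p^-1 * H y `^ (1 - p^-1))%:E)%E.
  rewrite Lnorm1; apply: eq_integral => y _ /=.
  by rewrite ger0_norm ?mulr_ge0 ?powR_ge0// /f /g invrK.
have Np : ('N[nu]_p%:E[EFin \o f] `^ p = \int[nu]_y (F y)%:E)%E.
  rewrite poweR_Lnorm//; apply: eq_integral => y _ /=.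
  by rewrite ger0_norm ?powR_ge0// /f -powRrM mulVf// powRr1.
have Nq : ('N[nu]_q%:E[EFin \o g] `^ q = \int[nu]_y (H y)%:E)%E.
  rewrite poweR_Lnorm//; apply: eq_integral => y _ /=.
  by rewrite ger0_norm ?powR_ge0// /g -powRrM mulVf// powRr1.
have := hoelder nu mf mg p0 q0 pq; rewrite N1 => /(ge0_lee_poweR (ltW p0)) h.
apply: (le_trans (h _)).
  by apply: integral_ge0 => y _; rewrite lee_fin mulr_ge0 ?powR_ge0.
by rewrite poweRM ?Lnorm_ge0// Np -qp -Nq -poweRrM mulrA divff// mul1r.
Qed.

(** Two-weight Schur test. Hoelder's inequality is applied in y to the splitting
    k g = (k u g^p)^(1/p) (k u^(-1/(p-1)))^(1-1/p), and Tonelli's theorem then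
    leaves an integral in x only. The test function u may vanish where the kernel
    does, so that kernels supported on a region need no restriction of the
    measures. *)
Lemma schur_test (d1 d2 : measure_display) (X : measurableType d1)
    (Y : measurableType d2) (R : realType)
    (mu : {sigma_finite_measure set X -> \bar R})
    (nu : {sigma_finite_measure set Y -> \bar R})
    (p B : R) (k : X * Y -> R) (w A : X -> R) (u v g : Y -> R) :
  1 < p -> 0 <= B ->
  measurable_fun setT k -> measurable_fun setT w -> measurable_fun setT A ->
  measurable_fun setT u -> measurable_fun setT v -> measurable_fun setT g ->
  (forall z, 0 <= k z) -> (forall x, 0 <= w x) ->
  (forall y, 0 <= u y) -> (forall y, 0 <= v y) -> (forall y, 0 <= g y) ->
  (forall x y, k (x, y) != 0 -> u y != 0) ->
  (forall x, \int[nu]_y (k (x, y) * u y `^ (- (p - 1)^-1))%:E <= (A x)%:E)%E ->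
  (forall y, \int[mu]_x (w x * A x `^ (p - 1) * k (x, y) * u y)%:E
     <= (B * v y)%:E)%E ->
  (\int[mu]_x ((\int[nu]_y (k (x, y) * g y)%:E) `^ p * (w x)%:E)
     <= B%:E * \int[nu]_y (g y `^ p * v y)%:E)%E.
Proof.
move=> p1 B0 mk mw mA mu_u mv mg k0 w0 u0 v0 g0 ku hA hB.
have p0 : 0 < p by lra.
have pn0 : p != 0 by rewrite gt_eqF.
have p1n0 : p - 1 != 0 by rewrite gt_eqF// subr_gt0.
have mpair1 (x : X) : measurable_fun [set: Y] (fun y => (x, y)).
  exact: measurable_fun_pair.
have mpair2 (y : Y) : measurable_fun [set: X] (fun x => (x, y)).
  exact: measurable_fun_pair.
have mk1 x : measurable_fun setT (fun y => k (x, y)).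
  exact: (measurableT_comp mk).
have mk2 y : measurable_fun setT (fun x => k (x, y)).
  exact: (measurableT_comp mk).
pose P (z : X * Y) := (w z.1 * A z.1 `^ (p - 1) * k z * (u z.2 * g z.2 `^ p))%:E.
have P0 z : (0 <= P z)%E by rewrite lee_fin !mulr_ge0 ?powR_ge0.
have mP : measurable_fun setT P.
  apply/measurable_EFinP; apply: measurable_funM; apply: measurable_funM => //.
  - apply: measurable_funM; first exact: (measurableT_comp mw).
    exact: measurable_fun_powR (measurableT_comp mA measurable_fst).
  - exact: (measurableT_comp mu_u measurable_snd).
  - exact: measurable_fun_powR (measurableT_comp mg measurable_snd).
have mG : measurable_fun setT (fun x => \int[nu]_y (k (x, y) * g y)%:E)%E.
  apply: (measurable_fun_fubini_tonelli_F (fun z : X * Y => (k z * g z.2)%:E)).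
    apply/measurable_EFinP; apply: measurable_funM => //.
    exact: (measurableT_comp mg measurable_snd).
  by move=> z; rewrite lee_fin mulr_ge0.
have A0 x : 0 <= A x.
  rewrite -lee_fin; apply: (le_trans _ (hA x)).
  by apply: integral_ge0 => y _; rewrite lee_fin mulr_ge0 ?powR_ge0.
apply: (@le_trans _ _ (\int[mu]_x \int[nu]_y P (x, y))%E).
  apply: ge0_le_integral => //.
  - by move=> x _; rewrite mule_ge0 ?poweR_ge0 ?lee_fin.
  - apply: emeasurable_funM; last exact/measurable_EFinP.
    exact: (measurableT_comp (measurable_poweR p)).
  - exact: (measurable_fun_fubini_tonelli_F P).
  move=> x _.
  pose F y := k (x, y) * (u y * g y `^ p).
  pose H y := k (x, y) * u y `^ (- (p - 1)^-1).
  have mF : measurable_fun setT F.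
    by apply: measurable_funM => //; apply: measurable_funM => //; exact: measurable_fun_powR.
  have mH : measurable_fun setT H.
    by apply: measurable_funM => //; exact: measurable_fun_powR.
  have F0 y : 0 <= F y by rewrite !mulr_ge0 ?powR_ge0.
  have H0 y : 0 <= H y by rewrite !mulr_ge0 ?powR_ge0.
  (* The exponents of k add up to 1 and those of u to 0. *)
  have kgE y : F y `^ p^-1 * H y `^ (1 - p^-1) = k (x, y) * g y.
    have [kxy|kxy] := eqVneq (k (x, y)) 0.
      by rewrite /F kxy !mul0r powR0 ?mul0r// invr_neq0.
    have uy := ku _ _ kxy.
    rewrite /F /H !powRM ?mulr_ge0 ?powR_ge0// -!powRrM mulfV// powRr1//.
    rewrite mulrACA -powRD ?kxy ?implybT// subrKC powRr1//; congr (_ * _).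
    rewrite mulrAC -powRD ?uy ?implybT// -[RHS]mul1r; congr (_ * _).
    rewrite -[RHS](powRr0 (u y)); congr (_ `^ _).
    by field; rewrite pn0 p1n0.
  have -> : (\int[nu]_y P (x, y) = (w x * A x `^ (p - 1))%:E * \int[nu]_y (F y)%:E)%E.
    rewrite -ge0_integralZl//.
    - by apply: eq_integral => y _; rewrite -EFinM /P /F /=; congr EFin; ring.
    - exact/measurable_EFinP.
    - by move=> y _; rewrite lee_fin.
    - by rewrite lee_fin mulr_ge0 ?powR_ge0.
  have := @hoelder_powR _ _ _ nu _ _ _ p1 mF mH F0 H0.
  under eq_integral do rewrite kgE.
  move=> hk; rewrite [leLHS]muleC EFinM -muleA.
  apply: lee_wpmul2l; rewrite ?lee_fin//; apply: (le_trans hk).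
  rewrite muleC; apply: lee_wpmul2r.
    by apply: integral_ge0 => y _; rewrite lee_fin.
  rewrite -poweR_EFin; apply: (ge0_lee_poweR _ _ (hA x)).
    by rewrite subr_ge0 ltW.
  by apply: integral_ge0 => y _; rewrite lee_fin; exact: H0.
rewrite (fubini_tonelli P)// -ge0_integralZl//; last 2 first.
- by apply/measurable_EFinP; apply: measurable_funM => //; exact: measurable_fun_powR.
- by move=> y _; rewrite lee_fin mulr_ge0 ?powR_ge0.
apply: ge0_le_integral => //.
- by move=> y _; exact: integral_ge0.
- exact: (measurable_fun_fubini_tonelli_G P).
- apply/measurable_EFinP; apply: measurable_funM => //.
  by apply: measurable_funM => //; exact: measurable_fun_powR.
move=> y _.
have -> : (\int[mu]_x P (x, y) = (g y `^ p)%:E *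
    \int[mu]_x (w x * A x `^ (p - 1) * k (x, y) * u y)%:E)%E.
  rewrite -ge0_integralZl//.
  - by apply: eq_integral => x _; rewrite -EFinM /P /=; congr EFin; ring.
  - apply/measurable_EFinP; apply: measurable_funM => //.
    apply: measurable_funM => //; apply: measurable_funM => //; exact: measurable_fun_powR.
  - by move=> x _; rewrite lee_fin !mulr_ge0 ?powR_ge0.
  - by rewrite lee_fin powR_ge0.
rewrite -EFinM mulrCA EFinM; apply: lee_wpmul2l; last exact: hB.
by rewrite lee_fin powR_ge0.
Qed.

(** * The Riemann-Liouville kernel on weighted spaces *)

(** For beta in [-1/2, 1/2], 4 (beta + 1) / (2 beta + 3) is at least 1 because
    2 beta + 3 <= 4 (beta + 1), and at least beta + 1 because 2 beta + 3 <= 4. *)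
Lemma lower_exponent_lt (R : realType) (beta gamma p : R) :
  - 2^-1 <= beta <= 2^-1 -> lower_exponent beta gamma < p ->
  1 < p /\ beta < p - 1.
Proof.
move=> /andP[b1 b2] hp.
have h0 : 0 < 2 * beta + 3 by lra.
have hb : 4 * ((beta + 1) / (2 * beta + 3)) < p.
  apply: le_lt_trans hp; rewrite /lower_exponent ler_pM2l//.
  by rewrite le_max lexx.
rewrite mulrA ltr_pdivrMr// in hb.
by split; nra.
Qed.

(** Cutting the kernel off outside a < t < x < b makes it a function on the whole
    plane, to which Tonelli's theorem applies although the domain of integration
    of the fractional integral depends on x. *)
Definition RL_kernel (R : realType) (a b alpha : R) (z : R * R) : R :=
  if [&& a < z.2, z.2 < z.1 & z.1 < b] then (z.1 - z.2) `^ (alpha - 1) else 0.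

Lemma RL_kernel_ge0 (R : realType) (a b alpha : R) (z : R * R) :
  0 <= RL_kernel a b alpha z.
Proof. by rewrite /RL_kernel; case: ifPn => // _; exact: powR_ge0. Qed.

Lemma measurable_RL_kernel (R : realType) (a b alpha : R) :
  measurable_fun setT (RL_kernel a b alpha).
Proof.
apply: measurable_fun_ifT => //.
  apply: measurable_and; [|apply: measurable_and]; exact: measurable_fun_ltr.
by apply: measurable_fun_powR; exact: measurable_funB.
Qed.

Lemma measurable_jacobi_weight (R : realType) (a b beta gamma : R) :
  measurable_fun setT (jacobi_weight a b beta gamma).
Proof.
by apply: measurable_funM; apply: measurable_fun_powR; exact: measurable_funB.
Qed.

Lemma jacobi_weight_ge0 (R : realType) (a b beta gamma x : R) :
  0 <= jacobi_weight a b beta gamma x.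
Proof. by rewrite mulr_ge0 ?powR_ge0. Qed.

(** Schur's test with u(t) = (t - a)^beta. With l = - beta / (p - 1), the beta
    integral of (t - a)^l (x - t)^(alpha - 1) gives A(x) = C1 (x - a)^(l + alpha),
    and beta + (l + alpha) (p - 1) = alpha (p - 1) is nonnegative, so the
    singularity of the weight at a has disappeared before integrating in x. *)
Lemma RL_kernel_schur (R : realType) (a b beta gamma p alpha : R) :
  a < b -> 0 < alpha -> 1 < p -> beta < p - 1 -> - 1 < gamma ->
  exists2 K : R, 0 <= K & forall g : R -> R,
    measurable_fun setT g -> (forall t, 0 <= g t) ->
    (\int[lebesgue_measure]_x
        ((\int[lebesgue_measure]_t (RL_kernel a b alpha (x, t) * g t)%:E) `^ p
         * (jacobi_weight a b beta gamma x)%:E)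
      <= K%:E * \int[lebesgue_measure]_t
                  (g t `^ p * jacobi_weight a b beta gamma t)%:E)%E.
Proof.
move=> ab al0 p1 bp ga1.
have p10 : 0 < p - 1 by lra.
have p1n0 : p - 1 != 0 by rewrite gt_eqF.
have al1 : - 1 < alpha - 1 by lra.
pose l := beta * - (p - 1)^-1.
have l1 : - 1 < l by rewrite /l mulrN ltrN2 ltr_pdivrMr ?mul1r.
have [C1 C10 hC1] := beta_integral_le l1 al1.
have [C2 C20 hC2] := beta_integral_le al1 ga1.
pose B := C1 `^ (p - 1) * (b - a) `^ (alpha * (p - 1)) * C2 * (b - a) `^ alpha.
have B0 : 0 <= B by rewrite !mulr_ge0 ?powR_ge0.
pose u t : R := (t - a) `^ beta.
pose A x : R := C1 * (x - a) `^ (l + alpha).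
have mu_u : measurable_fun setT u by apply: measurable_fun_powR; exact: measurable_funB.
have mA : measurable_fun setT A.
  by apply: measurable_funM => //; apply: measurable_fun_powR; exact: measurable_funB.
exists B => // g mg g0.
apply: (@schur_test _ _ _ _ _ lebesgue_measure lebesgue_measure p B
  (RL_kernel a b alpha) (jacobi_weight a b beta gamma) A u) => //.
- exact: measurable_RL_kernel.
- exact: measurable_jacobi_weight.
- exact: measurable_jacobi_weight.
- exact: RL_kernel_ge0.
- by move=> x; exact: jacobi_weight_ge0.
- by move=> x; exact: powR_ge0.
- by move=> x; exact: jacobi_weight_ge0.
- move=> x t; rewrite /RL_kernel/=; case: ifPn; last by rewrite eqxx.
  by move=> /and3P[at_ _ _] _; rewrite gt_eqF// powR_gt0// subr_gt0.
- move=> x.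
  have [/andP[ax xb]|xab] := boolP ((a < x) && (x < b)); last first.
    rewrite integral0_eq ?lee_fin ?mulr_ge0 ?powR_ge0// => t _.
    rewrite /RL_kernel/= ifF ?mul0r//; apply: contraNF xab.
    by move=> /and3P[h1 h2 ->]; rewrite (lt_trans h1 h2).
  have -> : (\int[lebesgue_measure]_t
        (RL_kernel a b alpha (x, t) * u t `^ (- (p - 1)^-1))%:E =
      \int[lebesgue_measure]_(t in `]a, x[)
        ((t - a) `^ l * (x - t) `^ (alpha - 1))%:E)%E.
    rewrite [RHS]integral_mkcond; apply: eq_integral => t _.
    rewrite patchE mem_setE in_itv/= /RL_kernel/= xb andbT.
    by case: ifPn => _; rewrite ?mul0r// mulrC /u -powRrM.
  by apply: (le_trans (hC1 _ _ ax)); rewrite /A -addrA subrK.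
move=> t.
have [/andP[at_ tb]|tab] := boolP ((a < t) && (t < b)); last first.
  rewrite integral0_eq ?lee_fin ?mulr_ge0 ?powR_ge0 ?jacobi_weight_ge0// => x _.
  rewrite /RL_kernel/= ifF ?mulr0 ?mul0r//; apply: contraNF tab.
  by move=> /and3P[-> h1 h2]; rewrite (lt_trans h1 h2).
(* c bounds every factor that is not singular in x on ]t, b[. *)
pose c := C1 `^ (p - 1) * (b - a) `^ (alpha * (p - 1)) * (t - a) `^ beta.
have c0 : 0 <= c by rewrite !mulr_ge0 ?powR_ge0.
have mtb : measurable_fun `]t, b[
    (fun x => ((x - t) `^ (alpha - 1) * (b - x) `^ gamma)%:E).
  apply/measurable_EFinP; apply: measurable_funTS; apply: measurable_funM;
    by apply: measurable_fun_powR; exact: measurable_funB.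
apply: (@le_trans _ _ (\int[lebesgue_measure]_(x in `]t, b[)
    (c%:E * ((x - t) `^ (alpha - 1) * (b - x) `^ gamma)%:E))%E).
  rewrite [leRHS]integral_mkcond; apply: ge0_le_integral => //.
  - move=> x _; rewrite lee_fin !mulr_ge0 ?powR_ge0 ?jacobi_weight_ge0//.
    exact: RL_kernel_ge0.
  - apply/measurable_EFinP; apply: measurable_funM => //; apply: measurable_funM.
      apply: measurable_funM; first exact: measurable_jacobi_weight.
      exact: measurable_fun_powR.
    apply: (measurableT_comp (@measurable_RL_kernel _ _ _ _)).
    exact: measurable_fun_pair.
  - apply/(measurable_restrictT _ _).1 => //.
    exact: emeasurable_funM.
  move=> x _; rewrite patchE mem_setE in_itv/= /RL_kernel/= at_/=.
  case: ifPn => [/andP[tx xb]|_]; last by rewrite mulr0 mul0r.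
  have ax : 0 < x - a by rewrite subr_gt0 (lt_trans at_).
  have axn0 : x - a != 0 by rewrite gt_eqF.
  rewrite -EFinM lee_fin /jacobi_weight /A /u powRM ?powR_ge0// -powRrM.
  have -> : (l + alpha) * (p - 1) = alpha * (p - 1) - beta.
    by rewrite /l; field.
  rewrite [(x - a) `^ (_ - beta)]powRB ?axn0 ?implybT//.
  have bn0 : (x - a) `^ beta != 0 by rewrite gt_eqF// powR_gt0.
  rewrite [leLHS](_ : _ = C1 `^ (p - 1) * (x - a) `^ (alpha * (p - 1)) *
    (t - a) `^ beta * ((x - t) `^ (alpha - 1) * (b - x) `^ gamma)); last by field.
  rewrite ler_wpM2r ?mulr_ge0 ?powR_ge0// /c ler_wpM2r ?powR_ge0//.
  rewrite ler_wpM2l ?powR_ge0// ge0_ler_powR ?nnegrE ?mulr_ge0//; lra.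
rewrite ge0_integralZl//; last first.
  by move=> x _; rewrite lee_fin mulr_ge0 ?powR_ge0.
apply: (@le_trans _ _ (c%:E * (C2 * (b - t) `^ (alpha - 1 + gamma + 1))%:E)%E).
  by apply: lee_wpmul2l; rewrite ?lee_fin//; exact: hC2.
have bt : 0 < b - t by rewrite subr_gt0.
have btn0 : b - t != 0 by rewrite gt_eqF.
rewrite -EFinM lee_fin (_ : alpha - 1 + gamma + 1 = alpha + gamma); last by ring.
rewrite powRD ?btn0 ?implybT// /c /B /jacobi_weight.
rewrite [leLHS](_ : _ = C1 `^ (p - 1) * (b - a) `^ (alpha * (p - 1)) * C2 *
  ((t - a) `^ beta * (b - t) `^ gamma) * (b - t) `^ alpha); last by ring.
rewrite [leRHS]mulrAC ler_wpM2l ?mulr_ge0 ?powR_ge0//.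
rewrite ge0_ler_powR ?nnegrE; lra.
Qed.

(** * Reduction of the complex integral to its majorant *)

Lemma integral_RL_kernel (R : realType) (a b alpha : R) (h : R -> R) (x : R) :
  x \in `]a, b[ ->
  (\int[lebesgue_measure]_t (RL_kernel a b alpha (x, t) * (h \_ `]a, b[) t)%:E =
   \int[lebesgue_measure]_(t in `]a, x[) (h t / (x - t) `^ (1 - alpha))%:E)%E.
Proof.
rewrite in_itv/= => /andP[ax xb].
rewrite [RHS]integral_mkcond; apply: eq_integral => t _.
rewrite !patchE !mem_setE !in_itv/= /RL_kernel/= xb andbT.
case: ifPn => [/andP[at_ tx]|_]; last by rewrite mul0r.
by rewrite at_ (lt_trans tx xb)/= mulrC -powRN opprB.
Qed.

(** The real-valued integral is by definition a measurable function of the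
    integrals of the positive and negative parts, whatever the values of these, and
    Tonelli's theorem makes both measurable in x. *)
Lemma measurable_Rintegral_param (d1 d2 : measure_display)
    (X : measurableType d1) (Y : measurableType d2) (R : realType)
    (nu : {sigma_finite_measure set Y -> \bar R}) (F : X * Y -> R) :
  measurable_fun setT F ->
  measurable_fun setT (fun x => \int[nu]_y F (x, y)).
Proof.
move=> /measurable_EFinP mF; rewrite /Rintegral.
apply: (measurableT_comp (fine_measurable measurableT)).
have -> : (fun x => \int[nu]_y (F (x, y))%:E)%E =
    (fubini_F nu (EFin \o F)^\+ \- fubini_F nu (EFin \o F)^\-)%E.
  apply/funext => x; rewrite integralE /fubini_F; congr (_ - _)%E.
    by apply: eq_integral => y _; rewrite !funeposE.
  by apply: eq_integral => y _; rewrite !funenegE.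
apply: emeasurable_funB.
  apply: measurable_fun_fubini_tonelli_F => //; exact: measurable_funepos.
apply: measurable_fun_fubini_tonelli_F => //; exact: measurable_funeneg.
Qed.

Lemma measurable_Rintegral_RL (R : realType) (a b alpha : R) (h : R -> R) :
  measurable_fun `]a, b[ h ->
  measurable_fun `]a, b[
    (fun x => \int[lebesgue_measure]_(t in `]a, x[) (h t / (x - t) `^ (1 - alpha))).
Proof.
move=> mh.
apply: (@eq_measurable_fun _ _ _ _ _ (fun x => \int[lebesgue_measure]_t
    (RL_kernel a b alpha (x, t) * (h \_ `]a, b[) t))).
  by move=> x; rewrite mem_setE => xab; rewrite /Rintegral integral_RL_kernel.
apply: measurable_funTS.
apply: (@measurable_Rintegral_param _ _ _ _ _ lebesgue_measure
  (fun z : R * R => RL_kernel a b alpha z * (h \_ `]a, b[) z.2)).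
apply: measurable_funM; first exact: measurable_RL_kernel.
apply: (@measurableT_comp _ _ _ _ _ _ (h \_ `]a, b[)) => //.
exact/(measurable_restrictT _ _).1.
Qed.

Lemma normc_le_ReIm (R : rcfType) (z : R[i]) :
  Normc.normc z <= `|complex.Re z| + `|complex.Im z|.
Proof.
case: z => x y /=; rewrite -[leRHS]ger0_norm ?addr_ge0// -[leRHS]sqrtr_sqr.
apply: ler_wsqrtr; rewrite sqrrD !real_normK ?num_real//.
by rewrite addrAC lerDl mulrn_wge0// mulr_ge0.
Qed.

Lemma normr_Re_le (R : rcfType) (z : R[i]) : `|complex.Re z| <= Normc.normc z.
Proof. by case: z => x y /=; rewrite -sqrtr_sqr; apply: ler_wsqrtr; rewrite lerDl sqr_ge0. Qed.

Lemma normr_Im_le (R : rcfType) (z : R[i]) : `|complex.Im z| <= Normc.normc z.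
Proof. by case: z => x y /=; rewrite -sqrtr_sqr; apply: ler_wsqrtr; rewrite lerDr sqr_ge0. Qed.

Lemma normc_ge0 (R : rcfType) (z : R[i]) : 0 <= Normc.normc z.
Proof. by apply: le_trans (normr_Re_le z). Qed.

Lemma normc_real (R : rcfType) (r : R) : Normc.normc (r%:C)%C = `|r|.
Proof. by rewrite /= expr0n addr0 sqrtr_sqr. Qed.

(** The denominator is a nonnegative real number, also where x - t is negative. *)
Lemma RL_integrand_real (R : realType) (alpha : R) (f : R -> R[i]) (x t : R) :
  [/\ complex.Re (RL_integrand alpha f x t) =
        complex.Re (f t) / (x - t) `^ (1 - alpha),
      complex.Im (RL_integrand alpha f x t) =
        complex.Im (f t) / (x - t) `^ (1 - alpha)
    & Normc.normc (RL_integrand alpha f x t) =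
        Normc.normc (f t) / (x - t) `^ (1 - alpha)].
Proof.
rewrite /RL_integrand; split; last first.
  by rewrite Normc.normcM Normc.normcV normc_real ger0_norm ?powR_ge0.
all: rewrite -fmorphV; case: (f t) => u v /=; by rewrite !mulr0 ?subr0 ?add0r ?addr0.
Qed.

Lemma measurable_normc (R : realType) (D : set R) (f : R -> R[i]) :
  Cmeasurable_fun D f -> measurable_fun D (fun x => Normc.normc (f x)).
Proof.
move=> [mre mim].
have -> : (fun x => Normc.normc (f x)) = fun x =>
  (complex.Re (f x) ^+ 2 + complex.Im (f x) ^+ 2) `^ 2^-1.
  apply/funext => x /=; case: (f x) => u v /=.
  by rewrite powR12_sqrt// addr_ge0 ?sqr_ge0.
apply: measurable_fun_powR; apply: measurable_funD; exact: measurable_funX.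
Qed.

(** When h is not integrable the right-hand side is infinite, while the
    left-hand side takes the default value 0 of the real-valued integral. *)
Lemma normr_Rintegral_le (d : measure_display) (T : measurableType d)
    (R : realType) (mu : {measure set T -> \bar R}) (D : set T) (h : T -> R) :
  measurable D -> measurable_fun D h ->
  ((`|\int[mu]_(t in D) h t|)%:E <= \int[mu]_(t in D) (`|h t|)%:E)%E.
Proof.
move=> mD /measurable_EFinP mh; apply: le_trans (le_abse_integral mu mD mh).
by rewrite /Rintegral; case: integral => [r| |] //=; rewrite normr0 leey.
Qed.

(** By [integral_RL_kernel] this is, for x in ]a, b[, the possibly infinite integral
    of |f(t)| (x - t)^(alpha - 1) over ]a, x[. *)
Definition RL_majorant (R : realType) (a b alpha : R) (f : R -> R[i]) (x : R) :
    \bar R :=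
  (\int[lebesgue_measure]_t
    (RL_kernel a b alpha (x, t) * ((fun s => Normc.normc (f s)) \_ `]a, b[) t)%:E)%E.

Lemma measurable_RL_integrand (R : realType) (a b alpha : R) (f : R -> R[i]) x :
  x \in `]a, b[ -> Cmeasurable_fun `]a, b[ f ->
  Cmeasurable_fun `]a, x[ (RL_integrand alpha f x).
Proof.
rewrite in_itv/= => /andP[ax xb] [mre mim].
have sub : `]a, x[ `<=` `]a, b[.
  by move=> t /=; rewrite !in_itv/= => /andP[-> tx]; exact: lt_trans xb.
have mk : measurable_fun `]a, x[ (fun t => ((x - t) `^ (1 - alpha))^-1).
  rewrite (_ : (fun t => _) = fun t => (x - t) `^ (- (1 - alpha))); last first.
    by apply/funext => t; rewrite powRN.
  by apply: measurable_fun_powR; exact: measurable_funB.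
split.
  rewrite (_ : (fun t => _) =
    fun t => complex.Re (f t) / (x - t) `^ (1 - alpha)); last first.
    by apply/funext => t; have [-> _ _] := RL_integrand_real alpha f x t.
  by apply: measurable_funM => //; exact: measurable_funS mre.
rewrite (_ : (fun t => _) =
    fun t => complex.Im (f t) / (x - t) `^ (1 - alpha)); last first.
    by apply/funext => t; have [_ -> _] := RL_integrand_real alpha f x t.
by apply: measurable_funM => //; exact: measurable_funS mim.
Qed.

Lemma integral_ReIm_le_majorant (R : realType) (a b alpha : R) (f : R -> R[i])
    (x : R) : x \in `]a, b[ -> Cmeasurable_fun `]a, b[ f ->
  (\int[lebesgue_measure]_(t in `]a, x[)
     (`|complex.Re (RL_integrand alpha f x t)|)%:E <= RL_majorant a b alpha f x)%E
  /\
  (\int[lebesgue_measure]_(t in `]a, x[)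
     (`|complex.Im (RL_integrand alpha f x t)|)%:E <= RL_majorant a b alpha f x)%E.
Proof.
move=> xab mf; have [mre mim] := measurable_RL_integrand alpha xab mf.
rewrite /RL_majorant integral_RL_kernel//.
have mn := measurable_normc (measurable_RL_integrand alpha xab mf).
have -> : (\int[lebesgue_measure]_(t in `]a, x[)
      (Normc.normc (f t) / (x - t) `^ (1 - alpha))%:E =
    \int[lebesgue_measure]_(t in `]a, x[)
      (Normc.normc (RL_integrand alpha f x t))%:E)%E.
  by apply: eq_integral => t _; have [_ _ ->] := RL_integrand_real alpha f x t.
split; apply: ge0_le_integral => //; try exact/measurable_EFinP.
- by apply/measurable_EFinP; exact: measurableT_comp.
- by move=> t _; rewrite lee_fin normr_Re_le.
- by apply/measurable_EFinP; exact: measurableT_comp.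
- by move=> t _; rewrite lee_fin normr_Im_le.
Qed.

Lemma Cintegrable_RL_integrand (R : realType) (a b alpha : R) (f : R -> R[i])
    (x : R) : x \in `]a, b[ -> Cmeasurable_fun `]a, b[ f ->
  (RL_majorant a b alpha f x < +oo)%E ->
  Cintegrable `]a, x[ (RL_integrand alpha f x).
Proof.
move=> xab mf Goo; have [mre mim] := measurable_RL_integrand alpha xab mf.
have [leRe leIm] := integral_ReIm_le_majorant alpha xab mf.
split; apply/integrableP; split.
- exact/measurable_EFinP.
- exact: le_lt_trans Goo.
- exact/measurable_EFinP.
- exact: le_lt_trans Goo.
Qed.

(** The factor 2 is the price of bounding the modulus by the sum of the absolute
    values of the real and imaginary parts. *)
Lemma normc_RL_integral_le (R : realType) (a b alpha : R) (f : R -> R[i])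
    (x : R) : x \in `]a, b[ -> Cmeasurable_fun `]a, b[ f ->
  ((Normc.normc (RL_integral a alpha f x))%:E <=
     (2 * `|(Gamma alpha)^-1|)%:E * RL_majorant a b alpha f x)%E.
Proof.
move=> xab mf; have [mre mim] := measurable_RL_integrand alpha xab mf.
have [leRe leIm] := integral_ReIm_le_majorant alpha xab mf.
rewrite /RL_integral Normc.normcM normc_real EFinM.
rewrite [2 * _]mulrC EFinM -muleA; apply: lee_wpmul2l; first by rewrite lee_fin.
apply: (le_trans (_ : _ <= (`|complex.Re (Cintegral `]a, x[ (RL_integrand alpha f x))|
   + `|complex.Im (Cintegral `]a, x[ (RL_integrand alpha f x))|)%:E)%E).
  by rewrite lee_fin normc_le_ReIm.
rewrite EFinD mule_natl mule2n; apply: leeD; rewrite /Cintegral/=.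
  by apply: le_trans leRe; exact: normr_Rintegral_le.
by apply: le_trans leIm; exact: normr_Rintegral_le.
Qed.

Lemma Cmeasurable_RL_integral (R : realType) (a b alpha : R) (f : R -> R[i]) :
  Cmeasurable_fun `]a, b[ f -> Cmeasurable_fun `]a, b[ (RL_integral a alpha f).
Proof.
move=> [mre mim].
have ReE x : complex.Re (RL_integral a alpha f x) = (Gamma alpha)^-1 *
    \int[lebesgue_measure]_(t in `]a, x[) (complex.Re (f t) / (x - t) `^ (1 - alpha)).
  rewrite /RL_integral /Cintegral/= mul0r subr0; congr (_ * _).
  by apply: eq_Rintegral => t _; have [-> _ _] := RL_integrand_real alpha f x t.
have ImE x : complex.Im (RL_integral a alpha f x) = (Gamma alpha)^-1 *
    \int[lebesgue_measure]_(t in `]a, x[) (complex.Im (f t) / (x - t) `^ (1 - alpha)).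
  rewrite /RL_integral /Cintegral/= mul0r addr0; congr (_ * _).
  by apply: eq_Rintegral => t _; have [_ -> _] := RL_integrand_real alpha f x t.
split.
  rewrite (funext ReE).
  by apply: measurable_funM => //; exact: measurable_Rintegral_RL.
rewrite (funext ImE).
by apply: measurable_funM => //; exact: measurable_Rintegral_RL.
Qed.

(** * Boundedness of the fractional integral *)

Theorem lemma1 (R : realType) (a b beta gamma p alpha : R)
    (hab : a < b)
    (hbeta : - 2^-1 <= beta <= 2^-1)
    (hgamma : - 2^-1 <= gamma <= 2^-1)
    (hMp : lower_exponent beta gamma < p)
    (hpm : (p%:E < upper_exponent beta gamma)%E)
    (halpha : 0 < alpha < 1) :
  exists C : R, 0 < C /\
    forall f : R -> complex R,
      wLp a b (jacobi_weight a b beta gamma) p f ->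
      [/\ {ae lebesgue_measure, forall x : R,
             x \in `]a, b[ -> Cintegrable `]a, x[ (RL_integrand alpha f x)},
          wLp a b (jacobi_weight a b beta gamma) p (RL_integral a alpha f)
        & (wLp_norm a b (jacobi_weight a b beta gamma) p (RL_integral a alpha f)
           <= C%:E * wLp_norm a b (jacobi_weight a b beta gamma) p f)%E].
Proof.
have [p1 bp] := lower_exponent_lt hbeta hMp.
have p0 : 0 < p by lra.
have pn0 : p != 0 by rewrite gt_eqF.
have pVn0 : p^-1 != 0 by rewrite invr_neq0.
have al0 : 0 < alpha by case/andP: halpha.
have ga1 : - 1 < gamma by case/andP: hgamma => ? _; lra.
have [K K0 hK] := RL_kernel_schur hab al0 p1 bp ga1.
set w := jacobi_weight a b beta gamma.
have mw : measurable_fun setT w := measurable_jacobi_weight a b beta gamma.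
have w0 x : 0 <= w x := jacobi_weight_ge0 a b beta gamma x.
pose c : R := 2 * `|(Gamma alpha)^-1|.
have c0 : 0 <= c by rewrite mulr_ge0.
pose C : R := (c `^ p * K) `^ p^-1.
have C0 : 0 <= C by exact: powR_ge0.
(* C is only known to be nonnegative. *)
exists (C + 1); split; first by lra.
move=> f [mf Nfoo].
pose g := (fun s => Normc.normc (f s)) \_ `]a, b[.
have mg : measurable_fun setT g.
  by apply/(measurable_restrictT _ _).1 => //; exact: measurable_normc.
have g0 t : 0 <= g t by rewrite /g patchE; case: ifP => // _; exact: normc_ge0.
pose G := RL_majorant a b alpha f.
have G0 x : (0 <= G x)%E.
  by apply: integral_ge0 => t _; rewrite lee_fin mulr_ge0 ?RL_kernel_ge0.
have mG : measurable_fun setT G.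
  apply: (@measurable_fun_fubini_tonelli_F _ _ _ _ _ lebesgue_measure
    (fun z : R * R => (RL_kernel a b alpha z * g z.2)%:E)).
    apply/measurable_EFinP; apply: measurable_funM.
      exact: measurable_RL_kernel.
    exact: (measurableT_comp mg measurable_snd).
  by move=> z; rewrite lee_fin mulr_ge0 ?RL_kernel_ge0.
pose S := (\int[lebesgue_measure]_(x in `]a, b[)
  (Normc.normc (f x) `^ p * w x)%:E)%E.
have S0 : (0 <= S)%E.
  by apply: integral_ge0 => x _; rewrite lee_fin mulr_ge0 ?powR_ge0.
have Soo : (S < +oo)%E by exact: lty_poweRy Nfoo.
have mGw : measurable_fun setT (fun x => G x `^ p * (w x)%:E)%E.
  apply: emeasurable_funM; last exact/measurable_EFinP.
  exact: (measurableT_comp (measurable_poweR p)).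
have Gw0 x : (0 <= G x `^ p * (w x)%:E)%E by rewrite mule_ge0 ?poweR_ge0 ?lee_fin.
have hG : (\int[lebesgue_measure]_x (G x `^ p * (w x)%:E) <= K%:E * S)%E.
  apply: (le_trans (hK _ mg g0)); rewrite le_eqVlt; apply/orP; left; apply/eqP.
  congr (_ * _)%E; rewrite /S [RHS]integral_mkcond; apply: eq_integral => t _.
  by rewrite /g !patchE; case: ifP => // _; rewrite powR0// mul0r.
have Goo : (\int[lebesgue_measure]_x (G x `^ p * (w x)%:E) < +oo)%E.
  by apply: (le_lt_trans hG); rewrite lte_mul_pinfty ?lee_fin.
have hnorm : (wLp_norm a b w p (RL_integral a alpha f)
    <= C%:E * wLp_norm a b w p f)%E.
  rewrite /wLp_norm -/S.
  apply: (@le_trans _ _ (((c `^ p * K)%:E * S) `^ p^-1)%E); last first.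
    by rewrite poweRM// ?lee_fin ?mulr_ge0 ?powR_ge0.
  have mRL := measurable_normc (Cmeasurable_RL_integral alpha mf).
  have p10 : 0 <= p^-1 by rewrite invr_ge0 ltW.
  apply: ge0_lee_poweR => //.
    by apply: integral_ge0 => x _; rewrite lee_fin mulr_ge0 ?powR_ge0.
  apply: (@le_trans _ _ (\int[lebesgue_measure]_(x in `]a, b[)
      ((c `^ p)%:E * (G x `^ p * (w x)%:E)))%E).
    apply: ge0_le_integral => //.
    - by move=> x _; rewrite lee_fin mulr_ge0 ?powR_ge0.
    - apply/measurable_EFinP; apply: measurable_funM; last exact: measurable_funTS.
      exact: measurable_fun_powR.
    - by apply: measurable_funTS; exact: emeasurable_funM.
    move=> x xab; rewrite EFinM muleA; apply: lee_wpmul2r; first by rewrite lee_fin.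
    have xab' : x \in `]a, b[ by [].
    rewrite -!poweR_EFin -poweRM ?lee_fin//; apply: ge0_lee_poweR.
    - exact: ltW.
    - by rewrite lee_fin normc_ge0.
    - exact: normc_RL_integral_le.
  rewrite ge0_integralZl ?lee_fin ?powR_ge0//; last exact: measurable_funTS.
  rewrite EFinM -muleA; apply: lee_wpmul2l; first by rewrite lee_fin powR_ge0.
  apply: le_trans hG; exact: ge0_subset_integral.
have N0 : (0 <= wLp_norm a b w p f)%E by exact: poweR_ge0.
split.
(* G^p w has a finite integral and w is positive on ]a, b[, so G is finite
   almost everywhere there. *)
- have intG : lebesgue_measure.-integrable setT (fun x => G x `^ p * (w x)%:E)%E.
    apply/integrableP; split => //.
    by under eq_integral do rewrite gee0_abs//.
  have := integrable_ae measurableT intG; apply: filterS => x /= /(_ I) fin xab.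
  apply: (Cintegrable_RL_integrand xab) => //; rewrite ltey; apply/eqP => Gx.
  move: fin xab; rewrite /G Gx poweRyr// in_itv/= => + /andP[ax xb].
  by rewrite gt0_mulye// lte_fin mulr_gt0// powR_gt0// subr_gt0.
- split; first exact: Cmeasurable_RL_integral.
  by apply: (le_lt_trans hnorm); rewrite lte_mul_pinfty ?lee_fin.
- apply: (le_trans hnorm); apply: lee_wpmul2r => //.
  by rewrite lee_fin lerDl.
Qed.
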